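(* Let $R$ be a resource measure on states and let $\tilde R(\Phi)=\max_\rho R(\Phi(\rho))$ be the associated output resource measure of channels. Suppose $\tilde R$ satisfies the tensorization property, i.e. $\tilde R(\Phi_1\otimes\Phi_2)=\max\{\tilde R(\Phi_1),\tilde R(\Phi_2)\}$ for all channels $\Phi_1,\Phi_2$. Then employing correlated input states does not preserve more resource in the output than employing product input states: for all channels $\Phi_1,\Phi_2$, $$\max_{\rho}R\big((\Phi_1\otimes\Phi_2)(\rho)\big)=\max_{\rho_1,\rho_2}R\big(\Phi_1(\rho_1)\otimes\Phi_2(\rho_2)\big),$$ where the left maximum is over all (possibly correlated or entangled) states $\rho$ of the joint input system and the right maximum is over all pairs of states $\rho_1,\rho_2$ of the individual input systems.
   Context: A class of quantum systems closed under tensor products is fixed. A resource measure is a function $R$ assigning a real number $R(\rho)\ge0$ to every state (density operator) of every system in the class. A channel is a completely positive trace-preserving map between systems in the class. For a channel $\Phi$, $\tilde R(\Phi)=\max_\rho R(\Phi(\rho))$, the maximum being over all input states; all maxima over states are understood as suprema when not attained. *)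

(* Defs.v *)
From HB Require Import structures.
From mathcomp Require Import all_boot all_order all_algebra.
From mathcomp Require Import complex ring lra.
From mathcomp Require Import all_classical all_reals ereal numfun esum.

Set Implicit Arguments.
Unset Strict Implicit.
Unset Printing Implicit Defensive.

Import Order.TTheory GRing.Theory Num.Theory.

Local Open Scope classical_set_scope.
Local Open Scope ring_scope.

Section PositiveKernels.
Variable R : realType.
Local Notation C := R[i].

(* Hilbert spaces are represented as l^2(I), I being the index set of an
   orthonormal basis (of any cardinality), and operators by their matrices
   A i k = <e_i, A e_k>. For finite I these are the usual complex matrices. *)
Definition kernel (I : Type) := I -> I -> C.

Identity Coercion kernel_fun : kernel >-> Funclass.

(* <v, A v> >= 0 for every finitely supported vector v; in the order of R[i]
   this includes that the sum is real. The points x k need not be distinct. *)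
Definition psd (I : Type) (A : kernel I) : Prop :=
  forall (n : nat) (x : 'I_n -> I) (v : 'I_n -> C),
    0 <= \sum_(k < n) \sum_(l < n) (v k)^* * A (x k) (x l) * v l.

Lemma psd0 I : psd (0 : kernel I).
Proof.
move=> n x v; apply: sumr_ge0 => k _; apply: sumr_ge0 => l _.
by rewrite mulr0 mul0r.
Qed.

Lemma psdD I (A B : kernel I) : psd A -> psd B -> psd (A + B).
Proof.
move=> pA pB n x v; have := addr_ge0 (pA n x v) (pB n x v).
rewrite -big_split /=; congr (_ <= _); apply: eq_bigr => k _.
rewrite -big_split /=; apply: eq_bigr => l _.
by rewrite -mulrDl -mulrDr.
Qed.

Lemma psd_comp I J (f : J -> I) (A : kernel I) :
  psd A -> psd (fun x y => A (f x) (f y)).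
Proof. by move=> pA n x v; apply: (pA n (f \o x) v). Qed.

Lemma psd_diag I (A : kernel I) i : psd A -> 0 <= A i i.
Proof.
move=> /(_ 1%N (fun=> i) (fun=> 1)).
by rewrite !big_ord1 mulr1 conjC1 mul1r.
Qed.

Lemma psd_diagRe I (A : kernel I) i : psd A -> 0 <= complex.Re (A i i).
Proof. by move=> /(psd_diag i); rewrite lecE /= => /andP[]. Qed.

Lemma psd_diagIm I (A : kernel I) i : psd A -> complex.Im (A i i) = 0.
Proof. by move=> /(psd_diag i); rewrite lecE /= => /andP[/eqP]. Qed.

Lemma psd2 I (A : kernel I) i j (a b : C) : psd A ->
  0 <= a^* * A i i * a + a^* * A i j * b + (b^* * A j i * a + b^* * A j j * b).
Proof.
move=> /(_ 2%N (fun k => if k == ord0 then i else j)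
               (fun k => if k == ord0 then a else b)).
by rewrite !big_ord_recl !big_ord0 /= !addr0.
Qed.

Lemma psd_herm I (A : kernel I) i j : psd A -> A j i = (A i j)^*.
Proof.
move=> pA; have := psd2 i j 1 1 pA; have := psd2 i j 1 'i pA.
have := psd_diagIm i pA; have := psd_diagIm j pA.
rewrite conjC1 conjCi !mul1r !mulr1.
have -> : A i i + A i j * 'i + (- 'i * A j i + - 'i * A j j * 'i)
  = A i i + A j j + (A i j - A j i) * 'i - ('i ^+ 2 + 1) * A j j by ring.
rewrite sqrCi addNr mul0r subr0 -complexiE -[(A i j)^*]/((A i j)^*%C).
case: (A i i) => aii bii; case: (A j j) => ajj bjj.
case: (A i j) => aij bij; case: (A j i) => aji bji /= -> ->.
rewrite !lecE /= => /andP[/eqP e1 _] /andP[/eqP e2 _].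
by apply/eqP; rewrite eq_complex /=; apply/andP; split; apply/eqP; lra.
Qed.

Lemma psd_gram n (N : 'M[C]_n) : psd (fun k l => N k l) ->
  exists L : 'M[C]_n, forall k l, N k l = \sum_m (L m k)^* * L m l.
Proof.
move=> pN; set P := spectralmx N; set d := spectral_diag N.
have NH : N \is hermsymmx.
  apply/is_hermitianmxP; rewrite expr0 scale1r; apply/matrixP => k l.
  by rewrite !mxE (psd_herm l k pN).
have /orthomx_spectralP NE := hermitian_normalmx NH.
have Pu : P \is unitarymx := spectral_unitarymx N.
have NE' k l : N k l = \sum_m (P m k)^* * d 0 m * P m l.
  rewrite {1}NE (invmx_unitary Pu) mxE; apply: eq_bigr => m _.
  congr (_ * _); rewrite mxE (bigD1 m) //= big1 ?addr0 => [|m' m'm].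
    by rewrite !mxE eqxx mulr1n.
  by rewrite !mxE (negPf m'm) mulr0n mulr0.
have dE : P *m N *m (invmx P) = diag_mx d.
  rewrite {1}NE !mulmxA mulmxV ?mul1mx ?mulmxK ?spectral_unit //.
have d_ge0 m : 0 <= d 0 m.
  have := pN n id (fun k => (P m k)^*).
  suff -> : \sum_(k < n) \sum_(l < n) (P m k)^*^* * N k l * (P m l)^* = d 0 m by [].
  have := congr1 (fun M : 'M[C]_n => M m m) dE.
  rewrite [RHS]mxE eqxx mulr1n => <-.
  rewrite (invmx_unitary Pu) mxE exchange_big /=; apply: eq_bigr => l _.
  by rewrite !mxE mulr_suml; apply: eq_bigr => k _; rewrite conjCK.
exists (\matrix_(m, k) (sqrtC (d 0 m) * P m k)) => k l.
rewrite NE'; apply: eq_bigr => m _; rewrite !mxE rmorphM /=.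
have -> : (sqrtC (d 0 m))^* = sqrtC (d 0 m).
  by apply/CrealP; rewrite ger0_real // sqrtC_ge0.
by rewrite -{1}[d 0 m]sqrtCK; ring.
Qed.

Lemma psdM I (A B : kernel I) :
  psd A -> psd B -> psd (fun x y => A x y * B x y).
Proof.
move=> pA pB n x v.
have /psd_gram[L LE] : psd (fun k l => (\matrix_(k', l') B (x k') (x l') : 'M[C]_n) k l).
  move=> m y w; have := psd_comp x pB y w.
  by under [X in _ -> _ <= X]eq_bigr do under eq_bigr do rewrite mxE.
have -> : \sum_(k < n) \sum_(l < n) (v k)^* * (A (x k) (x l) * B (x k) (x l)) * v l
   = \sum_(m < n) \sum_(k < n) \sum_(l < n)
       (L m k * v k)^* * A (x k) (x l) * (L m l * v l).
  rewrite [RHS]exchange_big; apply: eq_bigr => k _.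
  rewrite [RHS]exchange_big; apply: eq_bigr => l _.
  have := LE k l; rewrite mxE => ->.
  rewrite mulr_sumr mulr_sumr mulr_suml; apply: eq_bigr => m _.
  by rewrite rmorphM /=; ring.
by apply: sumr_ge0 => m _; apply: pA.
Qed.

End PositiveKernels.

Section RealSums.
Variable R : realType.

(* Unconditional sum of an absolutely summable family; the value is
   meaningless on other families. *)
Definition rsum (I : choiceType) (f : I -> R) : R :=
  fine (\esum_(i in [set: I]) (EFin \o f)^\+ i
        - \esum_(i in [set: I]) (EFin \o f)^\- i)%E.

Local Notation nsum f := (\esum_(i in [set: _]) (f i)%:E)%E.

Definition decomposable (I : choiceType) (f : I -> R) : Prop :=
  exists p q : I -> R, [/\ forall i, 0 <= p i, forall i, 0 <= q i,
    (nsum p < +oo)%E, (nsum q < +oo)%E & f = (fun i => p i - q i)].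

Section RealSumTheory.
Variable I : choiceType.
Implicit Types p q f g : I -> R.

Lemma nsum_fin p : (forall i, 0 <= p i) -> (nsum p < +oo)%E ->
  nsum p \is a fin_num.
Proof. by move=> p0 pfin; rewrite ge0_fin_numE // esum_ge0 // => i _; rewrite lee_fin. Qed.

Lemma nsumD p q : (forall i, 0 <= p i) -> (forall i, 0 <= q i) ->
  nsum (fun i => p i + q i) = (nsum p + nsum q)%E.
Proof. by move=> p0 q0; rewrite -esumD // => i _; rewrite lee_fin. Qed.

Lemma nsumZ (c : R) p : 0 <= c -> (forall i, 0 <= p i) ->
  nsum (fun i => c * p i) = (c%:E * nsum p)%E.
Proof.
move=> c0 p0; rewrite /esum -ereal_supZl //; last first.
  by apply/set0P; exists 0%E; exists set0; [exact: fsets_set0|rewrite fsbig_set0].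
congr ereal_sup; apply/seteqP; split=> [_ [A AP <-]|_ [_ [A AP <-] <-]].
  exists (\sum_(x \in A) (p x)%:E)%E; first by exists A.
  by rewrite ge0_mule_fsumr => [|i]; [|rewrite lee_fin].
exists A => //.
by rewrite ge0_mule_fsumr => [|i]; [|rewrite lee_fin].
Qed.

Lemma le_nsum p q : (forall i, p i <= q i) -> (nsum p <= nsum q)%E.
Proof. by move=> pq; apply: le_esum => i _; rewrite lee_fin. Qed.

Lemma rsumE p q : (forall i, 0 <= p i) -> (forall i, 0 <= q i) ->
  (nsum p < +oo)%E -> (nsum q < +oo)%E ->
  rsum (fun i => p i - q i) = fine (nsum p) - fine (nsum q).
Proof.
move=> p0 q0 pfin qfin; rewrite -fineB ?nsum_fin // /rsum; congr fine.
have := @esumB R I setT (EFin \o p) (EFin \o q); apply.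
- by rewrite /summable /=; under eq_esum do rewrite /= ger0_norm //.
- by rewrite /summable /=; under eq_esum do rewrite /= ger0_norm //.
- by move=> i _; rewrite lee_fin.
- by move=> i _; rewrite lee_fin.
Qed.

Lemma decomposableD f g : decomposable f -> decomposable g ->
  decomposable (fun i => f i + g i) /\
  rsum (fun i => f i + g i) = rsum f + rsum g.
Proof.
move=> [p [q [p0 q0 pf qf ->]]] [p' [q' [p'0 q'0 p'f q'f ->]]].
have P0 i : 0 <= p i + p' i by rewrite addr_ge0.
have Q0 i : 0 <= q i + q' i by rewrite addr_ge0.
have Pf : (nsum (fun i => p i + p' i)%R < +oo)%E by rewrite nsumD // lte_add_pinfty.
have Qf : (nsum (fun i => q i + q' i)%R < +oo)%E by rewrite nsumD // lte_add_pinfty.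
have -> : (fun i => p i - q i + (p' i - q' i)) =
          (fun i => (p i + p' i) - (q i + q' i)).
  by apply/funext => i; ring.
split; first by exists (fun i => p i + p' i), (fun i => q i + q' i).
rewrite !rsumE // !nsumD // !fineD ?nsum_fin //; ring.
Qed.

Lemma decomposableZ c f : decomposable f ->
  decomposable (fun i => c * f i) /\ rsum (fun i => c * f i) = c * rsum f.
Proof.
move=> [p [q [p0 q0 pf qf ->]]].
have [c0|/ltW c0] := leP 0 c.
  have Zf (r : I -> R) : (forall i, 0 <= r i) -> (nsum r < +oo -> nsum (fun i => c * r i)%R < +oo)%E.
    by move=> r0 rf; rewrite nsumZ // lte_mul_pinfty ?lee_fin.
  have -> : (fun i => c * (p i - q i)) = (fun i => c * p i - c * q i).
    by apply/funext => i; ring.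
  have cp i : 0 <= c * p i by rewrite mulr_ge0.
  have cq i : 0 <= c * q i by rewrite mulr_ge0.
  split; first by exists (fun i => c * p i), (fun i => c * q i); split; auto.
  by rewrite !rsumE ?Zf // !nsumZ // !fineM ?nsum_fin //= mulrBr.
rewrite -oppr_ge0 in c0.
have Zf (r : I -> R) : (forall i, 0 <= r i) -> (nsum r < +oo -> nsum (fun i => - c * r i)%R < +oo)%E.
  by move=> r0 rf; rewrite nsumZ // lte_mul_pinfty ?lee_fin.
have -> : (fun i => c * (p i - q i)) = (fun i => - c * q i - (- c) * p i).
  by apply/funext => i; ring.
have cp i : 0 <= - c * p i by rewrite mulr_ge0.
have cq i : 0 <= - c * q i by rewrite mulr_ge0.
split; first by exists (fun i => - c * q i), (fun i => - c * p i); split; auto.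
by rewrite !rsumE ?Zf // !nsumZ // !fineM ?nsum_fin //=; ring.
Qed.

Lemma decomposable_ge0 p : (forall i, 0 <= p i) -> (nsum p < +oo)%E ->
  decomposable p /\ rsum p = fine (nsum p).
Proof.
move=> p0 pf.
have z0 : (\esum_(i in [set: I]) (0 : R)%:E)%E = 0%E by rewrite esum1.
have e : p = (fun i => p i - 0) by apply/funext => i; rewrite subr0.
split; first by exists p, (fun=> 0); split; rewrite ?z0.
by rewrite [in LHS]e rsumE // ?z0 // subr0.
Qed.

Lemma decomposable0 : decomposable (fun _ : I => 0 : R) /\ rsum (fun _ : I => 0 : R) = 0.
Proof.
have z0 : (\esum_(i in [set: I]) (0 : R)%:E)%E = 0%E by rewrite esum1.
have [//||d r] := @decomposable_ge0 (fun=> 0); first by rewrite z0.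
by split=> //; rewrite r z0.
Qed.

End RealSumTheory.
End RealSums.

Section TraceClass.
Variable R : realType.
Local Notation C := R[i].

(* A positive semidefinite matrix with finite trace satisfies
   |A i k|^2 <= A i i * A k k, hence is the matrix of a bounded (indeed
   Hilbert-Schmidt) operator, and of a positive trace-class operator.
   The trace-class operators are the linear span of these. *)
Definition pos_trace_class (I : choiceType) (A : kernel R I) : Prop :=
  psd A /\ (\esum_(i in [set: I]) (complex.Re (A i i))%:E < +oo)%E.

Inductive trace_class (I : choiceType) : kernel R I -> Prop :=
| trace_class_pos A : pos_trace_class A -> trace_class A
| trace_class_lin (c : C) A B :
    trace_class A -> trace_class B -> trace_class (c *: A + B).

(* The diagonal of a trace-class operator is absolutely summable
   (trace_class_decomposable), so that trace is linear there (trace_lin). *)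
Definition trace (I : choiceType) (A : kernel R I) : C :=
  (rsum (fun i => complex.Re (A i i)) +i* rsum (fun i => complex.Im (A i i)))%C.

Section TraceClassTheory.
Variable I : choiceType.
Implicit Types A B : kernel R I.

Lemma pos_trace_class0 : pos_trace_class (0 : kernel R I).
Proof. by split; [exact: psd0|rewrite esum1]. Qed.

Lemma trace_class0 : trace_class (0 : kernel R I).
Proof. exact/trace_class_pos/pos_trace_class0. Qed.

Lemma trace_classD A B : trace_class A -> trace_class B -> trace_class (A + B).
Proof. by rewrite -{2}[A]scale1r; exact: trace_class_lin. Qed.

Lemma trace_classZ c A : trace_class A -> trace_class (c *: A).
Proof. by move=> tA; rewrite -[_ *: _]addr0; exact: trace_class_lin trace_class0. Qed.

Lemma trace_pos A : pos_trace_class A ->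
  trace A = (fine (\esum_(i in [set: I]) (complex.Re (A i i))%:E)%E)%:C%C.
Proof.
move=> [pA fA]; rewrite /trace.
have -> : (fun i => complex.Im (A i i)) = (fun=> 0).
  by apply/funext => i; exact: psd_diagIm.
rewrite (decomposable0 R I).2 (decomposable_ge0 _ fA).2 // => i.
exact: psd_diagRe.
Qed.

Lemma trace_class_decomposable A : trace_class A ->
  decomposable (fun i => complex.Re (A i i)) /\
  decomposable (fun i => complex.Im (A i i)).
Proof.
elim=> {A} [A [pA fA]|c A B _ [rA iA] _ [rB iB]].
  split; first by apply: (decomposable_ge0 _ fA).1 => i; exact: psd_diagRe.
  have -> : (fun i => complex.Im (A i i)) = (fun=> 0).
    by apply/funext => i; exact: psd_diagIm.
  exact: (decomposable0 R I).1.
case: c => a b; split.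
  have -> : (fun i => complex.Re (((a +i* b)%C *: A + B) i i)) =
    (fun i => (a * complex.Re (A i i) + - b * complex.Im (A i i)) + complex.Re (B i i)).
    apply/funext => i; rewrite -[(_ + _) i i]/((a +i* b)%C * A i i + B i i).
    by case: (A i i) => x y; case: (B i i) => z t /=; ring.
  do 2 (apply: (decomposableD _ _).1 => //); exact: (decomposableZ _ _).1.
have -> : (fun i => complex.Im (((a +i* b)%C *: A + B) i i)) =
  (fun i => (a * complex.Im (A i i) + b * complex.Re (A i i)) + complex.Im (B i i)).
  apply/funext => i; rewrite -[(_ + _) i i]/((a +i* b)%C * A i i + B i i).
  by case: (A i i) => x y; case: (B i i) => z t /=; ring.
do 2 (apply: (decomposableD _ _).1 => //); exact: (decomposableZ _ _).1.
Qed.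

Lemma trace_class_psd A : trace_class A -> psd A -> pos_trace_class A.
Proof.
move=> /trace_class_decomposable[[p [q [p0 q0 pf qf e]]] _] pA; split=> //.
apply: le_lt_trans pf; apply: le_nsum => i.
by rewrite (congr1 (fun h => h i) e) gerBl.
Qed.

Lemma psd_esum_ge0 A : psd A ->
  (0 <= \esum_(i in [set: I]) (complex.Re (A i i))%:E)%E.
Proof. by move=> pA; apply: esum_ge0 => i _; rewrite lee_fin psd_diagRe. Qed.

Lemma trace_lin c A B : trace_class A -> trace_class B ->
  trace (c *: A + B) = c * trace A + trace B.
Proof.
move=> /trace_class_decomposable[rA iA] /trace_class_decomposable[rB iB].
case: c => a b; rewrite /trace.
have -> : (fun i => complex.Re (((a +i* b)%C *: A + B) i i)) =
  (fun i => (a * complex.Re (A i i) + - b * complex.Im (A i i)) + complex.Re (B i i)).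
  apply/funext => i; rewrite -[(_ + _) i i]/((a +i* b)%C * A i i + B i i).
  by case: (A i i) => x y; case: (B i i) => z t /=; ring.
have -> : (fun i => complex.Im (((a +i* b)%C *: A + B) i i)) =
  (fun i => (a * complex.Im (A i i) + b * complex.Re (A i i)) + complex.Im (B i i)).
  apply/funext => i; rewrite -[(_ + _) i i]/((a +i* b)%C * A i i + B i i).
  by case: (A i i) => x y; case: (B i i) => z t /=; ring.
have [d1 e1] := decomposableZ a rA; have [d2 e2] := decomposableZ (- b) iA.
have [d3 e3] := decomposableZ a iA; have [d4 e4] := decomposableZ b rA.
have [d5 e5] := decomposableD d1 d2; have [d6 e6] := decomposableD d3 d4.
rewrite (decomposableD d5 rB).2 (decomposableD d6 iB).2 e5 e6 e1 e2 e3 e4.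
by apply/eqP; rewrite eq_complex /=; apply/andP; split; apply/eqP; ring.
Qed.

Definition trace_class_pred : {pred kernel R I} := fun A => `[< trace_class A >].

Fact trace_class_submod : submod_closed trace_class_pred.
Proof.
split; first exact/asboolP/trace_class0.
by move=> c A B /asboolP tA /asboolP tB; exact/asboolP/trace_class_lin.
Qed.

HB.instance Definition _ :=
  GRing.isSubmodClosed.Build C (kernel R I) trace_class_pred trace_class_submod.

Record tc := TC { tc_kernel :> kernel R I; _ : tc_kernel \in trace_class_pred }.

HB.instance Definition _ := [isSub for tc_kernel].
HB.instance Definition _ := [Choice of tc by <:].
HB.instance Definition _ := [SubChoice_isSubLmodule of tc by <:].

End TraceClassTheory.
End TraceClass.

Section Blocks.
Variable R : realType.
Local Notation C := R[i].

Definition mk_tc (I : choiceType) (A : kernel R I) (tA : trace_class A) :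
  tc R I := TC (asboolT tA).

Lemma tcP (I : choiceType) (A : tc R I) : trace_class A.
Proof. by case: A => A tA; exact/asboolP. Qed.

Lemma psd_fin (I : Type) (A : kernel R I) (T : finType) (x : T -> I) (v : T -> C) :
  psd A -> 0 <= \sum_(k : T) \sum_(l : T) (v k)^* * A (x k) (x l) * v l.
Proof.
move=> /(_ #|T| (x \o enum_val) (v \o enum_val)).
rewrite (reindex (@enum_val T T)) /=; last exact/onW_bij/enum_val_bij.
congr (_ <= _); apply: eq_bigr => k _.
by rewrite [RHS](reindex (@enum_val T T)) //=; exact/onW_bij/enum_val_bij.
Qed.

Lemma sum_bool_pair (T : finType) (F : bool * T -> C) :
  \sum_p F p = \sum_(t : T) (F (true, t) + F (false, t)).
Proof.
rewrite (eq_bigr (fun p => F (p.1, p.2))); last by case.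
by rewrite -(pair_bigA _ (fun b t => F (b, t))) big_bool big_split.
Qed.

Lemma esum_pair (A B : choiceType) (p : A * B -> \bar R) : (forall x, 0 <= p x)%E ->
  (\esum_(x in [set: (A * B)%type]) p x =
   \esum_(i in [set: A]) \esum_(j in [set: B]) p (i, j))%E.
Proof.
move=> p0; rewrite (@esum_esum _ _ _ setT (fun=> setT) (fun i j => p (i, j))) //.
rewrite (_ : _ `*`` _ = setT); last by apply/seteqP; split.
by apply: eq_esum => -[].
Qed.

Lemma esum_le_pair (I J : choiceType) (p : I * J -> \bar R) i :
  (forall x, 0 <= p x)%E ->
  (\esum_(j in [set: J]) p (i, j) <= \esum_(x in [set: I * J]) p x)%E.
Proof.
move=> p0; rewrite esum_pair //.
apply: esum_ge; exists [set i]; first by split; [exact: finite_set1|].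
by rewrite fsbig_set1.
Qed.

Section Slice.
Variables I J : choiceType.

Definition slice_kernel (X : kernel R (I * J)) (i k : I) : kernel R J :=
  fun j l => X (i, j) (k, l).

Let polar (X : kernel R (I * J)) (i k : I) (u : C) : kernel R J :=
  slice_kernel X i i + u *: slice_kernel X i k
  + (u^* *: slice_kernel X k i + (u^* * u) *: slice_kernel X k k).

Let polar_psd X i k u : psd X -> psd (polar X i k u).
Proof.
move=> pX n x v.
have := psd_fin (T := (bool * 'I_n)%type)
  (fun p => (if p.1 then i else k, x p.2)) (fun p => (if p.1 then 1 else u) * v p.2) pX.
rewrite sum_bool_pair; congr (_ <= _); apply: eq_bigr => s _.
rewrite !sum_bool_pair -big_split; apply: eq_bigr => t _.
rewrite !rmorphM /= conjC1 /polar.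
rewrite -[(_ + _) (x s) (x t)]/(X (i, x s) (i, x t) + u * X (i, x s) (k, x t) +
  (u^* * X (k, x s) (i, x t) + (u^* * u) * X (k, x s) (k, x t))).
ring.
Qed.

Let polar_pos X i k u : u^* * u = 1 -> pos_trace_class X ->
  pos_trace_class (polar X i k u).
Proof.
move=> u1 [pX fX]; split; first exact: polar_psd.
set p := fun x : I * J => complex.Re (X x x).
have p0 x : 0 <= p x by exact: psd_diagRe.
have pi m : (\esum_(j in [set: J]) (p (m, j))%:E < +oo)%E.
  by apply: le_lt_trans fX; apply: (esum_le_pair (p := EFin \o p)) => x; rewrite lee_fin.
apply: (@le_lt_trans _ _ (\esum_(j in [set: J]) (2 * (p (i, j) + p (k, j)))%:E)%E).
  apply: le_nsum => j.
  have := psd_diagRe j (polar_psd i k (- u) pX).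
  rewrite /polar rmorphN /= mulrNN u1 !scale1r !scaleNr.
  rewrite -[(_ + _ + _) j j]/(X (i, j) (i, j) - u * X (i, j) (k, j) +
   (- (u^* * X (k, j) (i, j)) + X (k, j) (k, j))).
  rewrite -[(_ + _ + _) j j]/(X (i, j) (i, j) + u * X (i, j) (k, j) +
   ((u^* * X (k, j) (i, j)) + X (k, j) (k, j))).
  by rewrite /p !raddfD /= !raddfN /=; lra.
have q0 j : 0 <= p (i, j) + p (k, j) by rewrite addr_ge0.
by rewrite nsumZ // nsumD // lte_mul_pinfty // ?lte_add_pinfty.
Qed.

Lemma slice_trace_class X i k : trace_class X -> trace_class (slice_kernel X i k).
Proof.
elim=> {X} [X pX|c X Y _ tX _ tY]; last first.
  exact: (trace_class_lin c tX tY).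
have ci : ('i : C)^* * 'i = 1 by rewrite conjCi mulNr -expr2 sqrCi opprK.
have P u : u^* * u = 1 -> trace_class (polar X i k u).
  by move=> u1; exact/trace_class_pos/polar_pos.
have -> : slice_kernel X i k = 4^-1 *: polar X i k 1 +
   ((- 4^-1) *: polar X i k (-1) + ((- 4^-1 * 'i) *: polar X i k 'i +
    ((4^-1 * 'i) *: polar X i k (- 'i) + 0))).
  apply/funext => j; apply/funext => l; rewrite /polar !rmorphN /= conjC1 conjCi.
  set a := X (i, j) (i, l); set b := X (i, j) (k, l).
  set d := X (k, j) (i, l); set e := X (k, j) (k, l).
  rewrite -[LHS]/b.
  rewrite -[RHS]/(4^-1 * ((a + 1 * b) + (1 * d + (1 * 1) * e)) +
   ((- 4^-1) * ((a + (-1) * b) + ((-1) * d + ((-1) * (-1)) * e)) +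
   ((- 4^-1 * 'i) * ((a + 'i * b) + ((- 'i) * d + ((- 'i) * 'i) * e)) +
   ((4^-1 * 'i) * ((a + (- 'i) * b) + ((- - 'i) * d + ((- - 'i) * (- 'i)) * e)) + 0)))).
  transitivity (4^-1 * (2 * b - 2 * ('i ^+ 2) * b + 2 * d + 2 * 'i ^+ 2 * d)).
    by rewrite sqrCi; field.
  by field.
do 4 (apply: trace_class_lin; first by apply: P; rewrite ?rmorphN /= ?conjC1 ?mulrNN ?mulr1).
exact: trace_class0.
Qed.

Definition slice (X : tc R (I * J)%type) (i k : I) : tc R J :=
  mk_tc (slice_trace_class i k (tcP X)).

End Slice.
End Blocks.

Section Channels.
Variable R : realType.
Local Notation C := R[i].

(* An n x n array X of trace-class operators on H is an operator on
   C^n (x) H, and the array of the Phi (X p q) is its image by id_n (x) Phi. *)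
Definition completely_positive (I J : choiceType) (Phi : tc R I -> tc R J) : Prop :=
  forall (n : nat) (X : 'I_n -> 'I_n -> tc R I),
    psd (fun p q : 'I_n * I => X p.1 q.1 p.2 q.2) ->
    psd (fun p q : 'I_n * J => Phi (X p.1 q.1) p.2 q.2).

(* A positive linear map between spaces of trace-class operators is bounded for
   the trace norm, so no continuity requirement is needed. *)
Record channel (I J : choiceType) := Channel {
  channel_map :> {linear tc R I -> tc R J};
  channel_cp : completely_positive channel_map;
  channel_tp : forall X : tc R I, trace (channel_map X) = trace X }.

Lemma channel_psd I J (Phi : channel I J) (X : tc R I) : psd X -> psd (Phi X).
Proof.
move=> pX; have := @channel_cp _ _ Phi 1 (fun _ _ => X) (psd_comp snd pX).
by move=> /(psd_comp (fun j => (ord0, j))).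
Qed.

Section Comp.
Variables (I J K : choiceType) (Psi : channel J K) (Phi : channel I J).

Fact comp_channel_cp : completely_positive (Psi \o Phi).
Proof.
move=> n X pX; apply: (@channel_cp _ _ Psi n (fun p q => Phi (X p q))).
exact: channel_cp.
Qed.

Fact comp_channel_tp X : trace ((Psi \o Phi) X) = trace X.
Proof. by rewrite /= !channel_tp. Qed.

Definition comp_channel : channel I K :=
  @Channel I K (Psi \o Phi) comp_channel_cp comp_channel_tp.
End Comp.

Section Reindex.
Variables (I J : choiceType) (f : J -> I) (g : I -> J).
Hypotheses (fK : cancel f g) (gK : cancel g f).

Let f_bij : set_bij [set: J] [set: I] f.
Proof.
split=> //; first by move=> x y _ _; exact: (can_inj fK).
by move=> x _; exists (g x).
Qed.

Definition reindex_kernel (A : kernel R I) : kernel R J := fun x y => A (f x) (f y).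

Let reindex_pos A : pos_trace_class A ->
  pos_trace_class (reindex_kernel A) /\ trace (reindex_kernel A) = trace A.
Proof.
move=> pA; have [psA fA] := pA.
have e : (\esum_(j in [set: J]) (complex.Re (reindex_kernel A j j))%:E =
          \esum_(i in [set: I]) (complex.Re (A i i))%:E)%E.
  by rewrite [RHS](@reindex_esum R J I setT setT f _ f_bij).
have pB : pos_trace_class (reindex_kernel A).
  by split; [exact: psd_comp | rewrite e].
by split=> //; rewrite !trace_pos // e.
Qed.

Let reindexP A : trace_class A ->
  trace_class (reindex_kernel A) /\ trace (reindex_kernel A) = trace A.
Proof.
elim=> {A} [A /reindex_pos[pA eA]|c A B tA [rA eA] tB [rB eB]].
  by split=> //; exact: trace_class_pos.
split; first exact: (trace_class_lin c rA rB).
by rewrite (trace_lin c tA tB) -eA -eB -(trace_lin c rA rB).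
Qed.

Definition reindex_tc (A : tc R I) : tc R J := mk_tc (reindexP (tcP A)).1.

Fact reindex_tc_linear : linear reindex_tc.
Proof. by move=> c A B; apply: val_inj. Qed.

HB.instance Definition _ :=
  GRing.isLinear.Build C (tc R I) (tc R J) *:%R reindex_tc reindex_tc_linear.

Fact reindex_cp : completely_positive reindex_tc.
Proof. by move=> n X; exact: (psd_comp (fun p => (p.1, f p.2))). Qed.

Fact reindex_tp (A : tc R I) : trace (reindex_tc A) = trace A.
Proof. exact: (reindexP (tcP A)).2. Qed.

Definition reindex_channel : channel I J :=
  @Channel I J reindex_tc reindex_cp reindex_tp.
End Reindex.

Section Ampliation.
Variables (I J K : choiceType) (Phi : channel J K).

(* id (x) Phi, acting on each block X_(i,k) of an operator X on
   l^2(I) (x) l^2(J). This also determines it on operators which are not finite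
   sums of elementary tensors. *)
Definition amp_kernel (X : tc R (I * J)%type) : kernel R (I * K) :=
  fun p q => Phi (slice X p.1 q.1) p.2 q.2.

Let amp_kernel_lin c X Y (tX : trace_class X) (tY : trace_class Y)
    (t : trace_class (c *: X + Y)) :
  amp_kernel (mk_tc t) = c *: amp_kernel (mk_tc tX) + amp_kernel (mk_tc tY).
Proof.
apply/funext => p; apply/funext => q; rewrite /amp_kernel.
have -> : slice (mk_tc t) p.1 q.1 =
    c *: slice (mk_tc tX) p.1 q.1 + slice (mk_tc tY) p.1 q.1.
  exact: val_inj.
by rewrite linearP.
Qed.

Let amp_psd n (X : 'I_n -> 'I_n -> tc R (I * J)%type) :
  psd (fun p q : 'I_n * (I * J) => X p.1 q.1 p.2 q.2) ->
  psd (fun p q : 'I_n * (I * K) => amp_kernel (X p.1 q.1) p.2 q.2).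
Proof.
move=> pX m x v.
have := @channel_cp _ _ Phi m
  (fun k l => slice (X (x k).1 (x l).1) (x k).2.1 (x l).2.1).
move=> /(_ (psd_comp (fun p : 'I_m * J => ((x p.1).1, ((x p.1).2.1, p.2))) pX)).
by move=> /(_ m (fun k => (k, (x k).2.2)) v).
Qed.

Let amp_psd1 (X : tc R (I * J)%type) : psd X -> psd (amp_kernel X).
Proof.
move=> pX; have := @amp_psd 1 (fun _ _ => X) (psd_comp snd pX).
by move=> /(psd_comp (fun j => (ord0, j))).
Qed.

Let amp_pos X : pos_trace_class X -> forall t : trace_class X,
  pos_trace_class (amp_kernel (mk_tc t)) /\ trace (amp_kernel (mk_tc t)) = trace X.
Proof.
move=> pX t; have [psX fX] := pX.
have psA := @amp_psd1 (mk_tc t) psX.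
have e : (\esum_(x in [set: (I * K)%type])
            (complex.Re (amp_kernel (mk_tc t) x x))%:E =
          \esum_(x in [set: (I * J)%type]) (complex.Re (X x x))%:E)%E.
  rewrite !esum_pair; try by move=> x; rewrite lee_fin; exact: psd_diagRe.
  apply: eq_esum => i _.
  have psl : psd (slice (mk_tc t) i i) := psd_comp (fun j => (i, j)) psX.
  have fsl : (\esum_(j in [set: J]) (complex.Re (X (i, j) (i, j)))%:E < +oo)%E.
    apply: le_lt_trans fX.
    apply: (@esum_le_pair R I J (fun x => (complex.Re (X x x))%:E)) => x.
    by rewrite lee_fin; exact: psd_diagRe.
  have pB := trace_class_psd (tcP (Phi (slice (mk_tc t) i i))) (channel_psd Phi psl).
  have := channel_tp Phi (slice (mk_tc t) i i).
  rewrite (trace_pos pB) trace_pos; last by split.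
  move=> /complexI /eqP; rewrite -eqe !fineK ?ge0_fin_numE ?psd_esum_ge0 //.
  - by move=> /eqP.
  - exact: pB.2.
  - exact: pB.1.
have pA : pos_trace_class (amp_kernel (mk_tc t)) by split=> //; rewrite e.
by split=> //; rewrite !trace_pos // e.
Qed.

Let ampP X : trace_class X -> forall t : trace_class X,
  trace_class (amp_kernel (mk_tc t)) /\ trace (amp_kernel (mk_tc t)) = trace X.
Proof.
elim=> {X} [X pX|c X Y tX IX tY IY] t.
  by have [pA eA] := amp_pos pX t; split=> //; exact: trace_class_pos.
rewrite (amp_kernel_lin tX tY t).
have [rX eX] := IX tX; have [rY eY] := IY tY.
split; first exact: (trace_class_lin c rX rY).
by rewrite (trace_lin c tX tY) -eX -eY -(trace_lin c rX rY).
Qed.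

Let mk_tcK (I' : choiceType) (A : tc R I') : mk_tc (tcP A) = A.
Proof. exact: val_inj. Qed.

Let amp_trace_class X : trace_class (amp_kernel X).
Proof. by have := (ampP (tcP X) (tcP X)).1; rewrite mk_tcK. Qed.

Definition amp_tc (X : tc R (I * J)%type) : tc R (I * K)%type :=
  mk_tc (amp_trace_class X).

Fact amp_tc_linear : linear amp_tc.
Proof.
move=> c X Y; apply: val_inj => /=.
by rewrite -[c *: X + Y]mk_tcK (amp_kernel_lin (tcP X) (tcP Y)) !mk_tcK.
Qed.

HB.instance Definition _ :=
  GRing.isLinear.Build C (tc R (I * J)%type) (tc R (I * K)%type) *:%R
    amp_tc amp_tc_linear.

Fact amp_cp : completely_positive amp_tc.
Proof. by move=> n X; exact: amp_psd. Qed.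

Fact amp_tp (X : tc R (I * J)%type) : trace (amp_tc X) = trace X.
Proof. by have := (ampP (tcP X) (tcP X)).2; rewrite mk_tcK. Qed.

Definition amp_channel : channel (I * J)%type (I * K)%type :=
  @Channel (I * J)%type (I * K)%type amp_tc amp_cp amp_tp.

End Ampliation.
End Channels.

Section TensorProducts.
Variable R : realType.
Local Notation C := R[i].

Section TensorKernel.
Variables I J : choiceType.

Definition tens_kernel (A : kernel R I) (B : kernel R J) : kernel R (I * J) :=
  fun p q => A p.1 q.1 * B p.2 q.2.

Let tens_pos A B : pos_trace_class A -> pos_trace_class B ->
  pos_trace_class (tens_kernel A B) /\
  trace (tens_kernel A B) = trace A * trace B.
Proof.
move=> pA pB; have [psA fA] := pA; have [psB fB] := pB.
have psAB : psd (tens_kernel A B) := psdM (psd_comp fst psA) (psd_comp snd psB).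
have a0 i : 0 <= complex.Re (A i i) by exact: psd_diagRe.
have b0 j : 0 <= complex.Re (B j j) by exact: psd_diagRe.
set SA := (\esum_(i in [set: I]) (complex.Re (A i i))%:E)%E in fA.
set SB := (\esum_(j in [set: J]) (complex.Re (B j j))%:E)%E in fB.
have SAfin : SA \is a fin_num by rewrite nsum_fin.
have SBfin : SB \is a fin_num by rewrite nsum_fin.
have e : (\esum_(x in [set: (I * J)%type])
    (complex.Re (tens_kernel A B x x))%:E = (fine SA * fine SB)%:E)%E.
  rewrite esum_pair; last by move=> x; rewrite lee_fin; exact: psd_diagRe.
  transitivity (\esum_(i in [set: I]) (fine SB * complex.Re (A i i))%:E)%E.
    apply: eq_esum => i _.
    transitivity (\esum_(j in [set: J]) (complex.Re (A i i) * complex.Re (B j j))%:E)%E.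
      apply: eq_esum => j _; congr EFin; rewrite /tens_kernel /=.
      have := psd_diagIm i psA; have := psd_diagIm j psB.
      by case: (A i i) => x y; case: (B j j) => z t /= -> ->; rewrite mulr0 subr0.
    by rewrite nsumZ // -/SB -[SB]fineK // -EFinM mulrC.
  rewrite nsumZ ?fine_ge0 ?psd_esum_ge0 // -/SA -[X in (_ * X)%E]fineK //.
  by rewrite -EFinM mulrC.
have pAB : pos_trace_class (tens_kernel A B) by split=> //; rewrite e ltry.
split=> //; rewrite !trace_pos // e -/SA -/SB.
by rewrite -[fine (_ * _)%:E]/(fine SA * fine SB) rmorphM.
Qed.

Let tensP A B : trace_class A -> trace_class B ->
  trace_class (tens_kernel A B) /\
  trace (tens_kernel A B) = trace A * trace B.
Proof.
move=> tA tB; elim: tA => {A} [A pA|c A A' tA [rA eA] tA' [rA' eA']].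
  elim: tB => {B} [B pB|c B B' tB [rB eB] tB' [rB' eB']].
    by have [pAB eAB] := tens_pos pA pB; split=> //; exact: trace_class_pos.
  have -> : tens_kernel A (c *: B + B') = c *: tens_kernel A B + tens_kernel A B'.
    apply/funext => p; apply/funext => q.
    rewrite -[LHS]/(A p.1 q.1 * (c * B p.2 q.2 + B' p.2 q.2)).
    rewrite -[RHS]/(c * (A p.1 q.1 * B p.2 q.2) + A p.1 q.1 * B' p.2 q.2).
    by ring.
  split; first exact: (trace_class_lin c rB rB').
  by rewrite (trace_lin c rB rB') (trace_lin c tB tB') eB eB'; ring.
have -> : tens_kernel (c *: A + A') B = c *: tens_kernel A B + tens_kernel A' B.
  apply/funext => p; apply/funext => q.
  rewrite -[LHS]/((c * A p.1 q.1 + A' p.1 q.1) * B p.2 q.2).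
  rewrite -[RHS]/(c * (A p.1 q.1 * B p.2 q.2) + A' p.1 q.1 * B p.2 q.2).
  by ring.
split; first exact: (trace_class_lin c rA rA').
by rewrite (trace_lin c rA rA') (trace_lin c tA tA') eA eA'; ring.
Qed.

Definition tens_tc (A : tc R I) (B : tc R J) : tc R (I * J)%type :=
  mk_tc (tensP (tcP A) (tcP B)).1.

Lemma psd_tens (A : tc R I) (B : tc R J) : psd A -> psd B -> psd (tens_tc A B).
Proof. by move=> pA pB; exact: psdM (psd_comp fst pA) (psd_comp snd pB). Qed.

Lemma trace_tens (A : tc R I) (B : tc R J) :
  trace (tens_tc A B) = trace A * trace B.
Proof. exact: (tensP (tcP A) (tcP B)).2. Qed.

End TensorKernel.

Definition flip (A B : Type) (p : A * B) : B * A := (p.2, p.1).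

Lemma flipK (A B : Type) : cancel (@flip A B) (@flip B A).
Proof. by case. Qed.

Definition swap_channel (I J : choiceType) : channel R (I * J)%type (J * I)%type :=
  reindex_channel R (@flipK J I) (@flipK I J).

(* Phi1 (x) Phi2 := (Phi1 (x) id) o (id (x) Phi2); see prod_channel_tens. *)
Definition prod_channel (I1 I2 J1 J2 : choiceType)
    (Phi1 : channel R I1 J1) (Phi2 : channel R I2 J2) :
    channel R (I1 * I2)%type (J1 * J2)%type :=
  comp_channel (swap_channel J2 J1)
    (comp_channel (amp_channel J2 Phi1)
      (comp_channel (swap_channel I1 J2) (amp_channel I1 Phi2))).

Lemma prod_channel_tens (I1 I2 J1 J2 : choiceType)
    (Phi1 : channel R I1 J1) (Phi2 : channel R I2 J2) (A : tc R I1) (B : tc R I2) :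
  prod_channel Phi1 Phi2 (tens_tc A B) = tens_tc (Phi1 A) (Phi2 B).
Proof.
pose X : tc R (J2 * I1)%type :=
  swap_channel _ _ (amp_channel I1 Phi2 (tens_tc A B)).
have XE j j' : slice X j j' = (Phi2 B) j j' *: A.
  apply: val_inj; apply/funext => i; apply/funext => i'.
  rewrite -[LHS]/(Phi2 (slice (tens_tc A B) i i') j j').
  have -> : slice (tens_tc A B) i i' = A i i' *: B by exact: val_inj.
  by rewrite linearZ -[LHS]/(A i i' * Phi2 B j j') mulrC.
apply: val_inj; apply/funext => p; apply/funext => q.
rewrite -[LHS]/(Phi1 (slice X p.2 q.2) p.1 q.1) XE linearZ.
by rewrite -[LHS]/(Phi2 B p.2 q.2 * Phi1 A p.1 q.1) mulrC.
Qed.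

End TensorProducts.

Section ResourceMeasures.
Variable R : realType.

Record state (I : choiceType) := State {
  state_op :> tc R I;
  state_psd : psd state_op;
  state_trace : trace state_op = 1 }.

Definition channel_state (I J : choiceType) (Phi : channel R I J)
    (rho : state I) : state J :=
  @State J (Phi rho) (channel_psd Phi (state_psd rho))
    (etrans (channel_tp Phi rho) (state_trace rho)).

Fact prod_state_trace (I J : choiceType) (rho : state I) (sigma : state J) :
  trace (tens_tc rho sigma) = 1.
Proof. by rewrite trace_tens !state_trace mulr1. Qed.

Definition prod_state (I J : choiceType) (rho : state I) (sigma : state J) :
    state (I * J)%type :=
  @State (I * J)%type (tens_tc rho sigma)
    (psd_tens (state_psd rho) (state_psd sigma)) (prod_state_trace rho sigma).

(* A class of quantum systems closed under tensor products. The space of the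
   system s is l^2(onb s), and the space of tensor s t is identified with
   l^2(onb s) (x) l^2(onb t) by the bijection between their bases. Distinct
   systems may have the same space, so that a resource may depend on more
   structure than the space. Spaces are nonzero. *)
Record system_class := SystemClass {
  system :> Type;
  onb : system -> choiceType;
  onb_inhabited : forall s, inhabited (onb s);
  tensor : system -> system -> system;
  pair_onb : forall s t, onb s * onb t -> onb (tensor s t);
  split_onb : forall s t, onb (tensor s t) -> onb s * onb t;
  pair_onbK : forall s t, cancel (@pair_onb s t) (@split_onb s t);
  split_onbK : forall s t, cancel (@split_onb s t) (@pair_onb s t) }.

Variable Q : system_class.

Definition join_channel (s t : Q) :
    channel R (onb s * onb t)%type (onb (tensor s t)) :=
  reindex_channel R (@split_onbK Q s t) (@pair_onbK Q s t).

Definition split_channel (s t : Q) :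
    channel R (onb (tensor s t)) (onb s * onb t)%type :=
  reindex_channel R (@pair_onbK Q s t) (@split_onbK Q s t).

Definition tensor_state (s t : Q) (rho : state (onb s)) (sigma : state (onb t)) :
    state (onb (tensor s t)) :=
  channel_state (join_channel s t) (prod_state rho sigma).

Definition tensor_channel (s1 t1 s2 t2 : Q)
    (Phi1 : channel R (onb s1) (onb t1)) (Phi2 : channel R (onb s2) (onb t2)) :
    channel R (onb (tensor s1 s2)) (onb (tensor t1 t2)) :=
  comp_channel (join_channel t1 t2)
    (comp_channel (prod_channel Phi1 Phi2) (split_channel s1 s2)).

Record resource_measure := ResourceMeasure {
  resource :> forall s : Q, state (onb s) -> R;
  resource_ge0 : forall s (rho : state (onb s)), 0 <= resource rho }.

(* The supremum is taken in the extended reals since resources of states may be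
   unbounded. *)
Definition output_measure (M : resource_measure) (s t : Q)
    (Phi : channel R (onb s) (onb t)) : \bar R :=
  ereal_sup [set (M t (channel_state Phi rho))%:E | rho in [set: state (onb s)]].

End ResourceMeasures.

(* Main.v *)
(* Apply tensorization to the constant channels X |-> tr(X) sigma1 and
   X |-> tr(X) sigma2. Their product is again constant, with value
   sigma1 (x) sigma2, even on entangled inputs; hence
   R(sigma1 (x) sigma2) = max(R(sigma1), R(sigma2)). So the supremum over
   product inputs is max(R~(Phi1), R~(Phi2)), which is R~(Phi1 (x) Phi2) by
   tensorization again. *)
From HB Require Import structures.
Require Import Defs.
From mathcomp Require Import all_boot all_order all_algebra complex ring.
From mathcomp Require Import all_classical all_reals ereal esum.

Set Implicit Arguments.
Unset Strict Implicit.
Unset Printing Implicit Defensive.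

Import Order.TTheory GRing.Theory Num.Theory.

(** * Complete positivity of the trace *)

Section Trace.
Local Open Scope ring_scope.
Variable R : realType.
Local Notation C := R[i].

(** Only on trace-class operators is the trace linear; fixing the domain [tc R I] lets it carry a
    linear structure. *)
Definition tc_trace (I : choiceType) (A : tc R I) : C := trace A.

Fact tc_trace_linear (I : choiceType) : scalar (@tc_trace I).
Proof. by move=> c A B; exact: (trace_lin c (tcP A) (tcP B)). Qed.

HB.instance Definition _ (I : choiceType) :=
  GRing.isLinear.Build C (tc R I) C *%R (@tc_trace I) (@tc_trace_linear I).

Lemma tc_traceZ (I : choiceType) c (A : tc R I) :
  tc_trace (c *: A) = c * tc_trace A.
Proof. exact: linearZ. Qed.

Lemma tc_trace_ge0 (I : choiceType) (A : tc R I) : psd A -> 0 <= tc_trace A.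
Proof.
move=> pA; have tA := trace_class_psd (tcP A) pA.
by rewrite /tc_trace trace_pos // ler0c fine_ge0 // psd_esum_ge0.
Qed.

Lemma tc_sumE (I : choiceType) n (F : 'I_n -> tc R I) i j :
  (\sum_(k < n) F k) i j = \sum_(k < n) F k i j.
Proof. by elim/big_rec2: _ => // k A a _ <-. Qed.

(** Contracting the block array with a vector [v] gives a positive operator [A], whose trace is the
    quadratic form at [v]. *)
Lemma psd_tc_trace_blocks (I : choiceType) n (X : 'I_n -> 'I_n -> tc R I) :
  psd (fun p q : 'I_n * I => X p.1 q.1 p.2 q.2) ->
  psd (fun p q : 'I_n => tc_trace (X p q)).
Proof.
move=> pX m x v.
pose A := \sum_(k < m) \sum_(l < m) ((v k)^* * v l) *: X (x k) (x l).
suff pA : psd A.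
  have := tc_trace_ge0 pA; rewrite /A raddf_sum /=; congr (_ <= _).
  apply: eq_bigr => k _; rewrite raddf_sum /=; apply: eq_bigr => l _.
  by rewrite linearZ /= mulrAC.
move=> n' y w.
(* The form of [A] at [w] is that of the whole array at the elementary tensor of [v] and [w]; what
   remains is reordering sums. *)
have := psd_fin (T := ('I_m * 'I_n')%type)
  (fun p => (x p.1, y p.2)) (fun p => v p.1 * w p.2) pX.
congr (_ <= _).
have E : forall s t, A (y s) (y t) =
   \sum_(k < m) \sum_(l < m) (v k)^* * v l * X (x k) (x l) (y s) (y t).
  move=> s t; rewrite /A tc_sumE; apply: eq_bigr => k _.
  by rewrite tc_sumE; apply: eq_bigr.
rewrite -(pair_bigA _ (fun k s => \sum_(q : 'I_m * 'I_n') (v k * w s)^* *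
   X (x k) (x q.1) (y s) (y q.2) * (v q.1 * w q.2))) /= exchange_big /=.
apply: eq_bigr => s _.
under eq_bigr => k _ do rewrite -(pair_bigA _ (fun l t => (v k * w s)^* *
   X (x k) (x l) (y s) (y t) * (v l * w t))) /= exchange_big /=.
rewrite exchange_big /=; apply: eq_bigr => t _.
rewrite E mulr_sumr mulr_suml; apply: eq_bigr => k _.
rewrite mulr_sumr mulr_suml; apply: eq_bigr => l _.
by rewrite rmorphM /=; ring.
Qed.

(** * Existence of states *)

Section PureState.
Variables (I : choiceType) (e : I).

(** The projection onto the basis vector [e]. It shows that every system has a state. *)
Definition pure_kernel : kernel R I := fun i j => (i == e)%:R * (j == e)%:R.

Fact pure_kernel_psd : psd pure_kernel.
Proof.
move=> n x v; set z := \sum_(k < n) (x k == e)%:R * v k.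
suff -> : \sum_(k < n) \sum_(l < n) (v k)^* * pure_kernel (x k) (x l) * v l
    = z^* * z by rewrite mulrC mul_conjC_ge0.
rewrite rmorph_sum mulr_suml; apply: eq_bigr => k _.
rewrite mulr_sumr; apply: eq_bigr => l _.
by rewrite rmorphM /= conjC_nat /pure_kernel; ring.
Qed.

Fact pure_kernel_esum :
  (\esum_(i in [set: I]) (complex.Re (pure_kernel i i))%:E = 1)%E.
Proof.
rewrite (esumID [set e]%classic); last first.
  by move=> i _; rewrite lee_fin; apply: psd_diagRe; exact: pure_kernel_psd.
rewrite setTI esum_set1; last by rewrite lee_fin; apply: psd_diagRe; exact: pure_kernel_psd.
rewrite esum1 => [|i [_ /= /eqP/negPf ie]]; last by rewrite /pure_kernel ie mul0r.
by rewrite adde0 /pure_kernel eqxx mulr1.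
Qed.

Fact pure_kernel_pos : pos_trace_class pure_kernel.
Proof. by split; [exact: pure_kernel_psd | rewrite pure_kernel_esum ltry]. Qed.

Fact pure_kernel_trace : trace pure_kernel = 1.
Proof. by rewrite (trace_pos pure_kernel_pos) pure_kernel_esum. Qed.

Definition pure_state : state R I :=
  @State R I (mk_tc (trace_class_pos pure_kernel_pos))
    pure_kernel_psd pure_kernel_trace.
End PureState.

Lemma state_inj (I : choiceType) (rho sigma : state R I) :
  (forall i j, rho i j = sigma i j) -> rho = sigma.
Proof.
case: rho sigma => [A pA tA] [B pB tB] /= AB.
have e : A = B by apply: val_inj; apply/funext => i; apply/funext => j; exact: AB.
by case: B / e pB tB {AB} => pB tB; rewrite (Prop_irrelevance pA pB) (Prop_irrelevance tA tB).
Qed.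

(** A zero diagonal would give trace 0 instead of 1. The entry found here serves as a divisor
    below. *)
Lemma state_diag_neq0 (I : choiceType) (rho : state R I) :
  exists i, rho i i != 0.
Proof.
apply: contrapT => /forallNP rho0.
have z i : rho i i = 0 by apply/eqP/negPn/negP/rho0.
have := state_trace rho; rewrite /trace.
under eq_fun do rewrite z; under [X in (_ +i* rsum X)%C]eq_fun do rewrite z.
rewrite (decomposable0 R I).2 => /eqP.
by rewrite eq_sym oner_eq0.
Qed.

(** * Constant channels and their products *)

Section ConstantChannel.
Variables (I J : choiceType) (sigma : state R J).

Definition const_map (X : tc R I) : tc R J := tc_trace X *: (sigma : tc R J).

Fact const_map_linear : linear const_map.
Proof. by move=> c X Y; rewrite /const_map linearP scalerDl scalerA. Qed.

HB.instance Definition _ :=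
  GRing.isLinear.Build C (tc R I) (tc R J) *:%R const_map const_map_linear.

Fact const_map_cp : completely_positive const_map.
Proof.
move=> n X /psd_tc_trace_blocks pX.
(* The image array is the entrywise product of the block traces and [sigma], so the Schur product
   theorem applies. *)
exact: psdM (psd_comp fst pX) (psd_comp snd (state_psd sigma)).
Qed.

Fact const_map_tp (X : tc R I) : trace (const_map X) = trace X.
Proof.
rewrite -[LHS]/(tc_trace (const_map X)) linearZ /=.
by rewrite [tc_trace sigma]state_trace mulr1.
Qed.

Definition const_channel : channel R I J :=
  @Channel R I J const_map const_map_cp const_map_tp.

Lemma const_channel_state rho : channel_state const_channel rho = sigma.
Proof.
apply: state_inj => i j.
rewrite -[LHS]/(tc_trace (rho : tc R I) * sigma i j).
by rewrite [tc_trace _]state_trace mul1r.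
Qed.
End ConstantChannel.

(** As [rho] may be entangled, [prod_channel_tens] does not suffice. The second channel already
    turns [rho] into [sigma2] tensored with a partial trace of [rho], and the first then acts on a
    product. *)
Lemma prod_const_channel_state (I1 I2 J1 J2 : choiceType)
    (sigma1 : state R J1) (sigma2 : state R J2) (rho : state R (I1 * I2)%type) :
  channel_state (prod_channel (const_channel I1 sigma1) (const_channel I2 sigma2)) rho
  = prod_state sigma1 sigma2.
Proof.
pose X : tc R (J2 * I1)%type :=
  swap_channel R _ _ (amp_channel I1 (const_channel I2 sigma2) rho).
(* The partial trace of [rho] over the second factor, at first a mere kernel. *)
pose ptr : kernel R I1 := fun i k => tc_trace (slice (rho : tc R (I1 * I2)%type) i k).
have XE j j' i i' : slice X j j' i i' = sigma2 j j' * ptr i i'.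
  by rewrite [RHS]mulrC.
have [j0 nz] := state_diag_neq0 sigma2.
(* [ptr] is a multiple of a block of [X], which shows that it is trace class. *)
pose P : tc R I1 := (sigma2 j0 j0)^-1 *: slice X j0 j0.
have XP j j' : slice X j j' = sigma2 j j' *: P.
  apply: val_inj; apply/funext => i; apply/funext => i'; rewrite [LHS]XE.
  rewrite -[RHS]/(sigma2 j j' * ((sigma2 j0 j0)^-1 * slice X j0 j0 i i')).
  by rewrite XE mulKf.
set Y := channel_state _ _.
have YE p q : Y p q = tc_trace P * prod_state sigma1 sigma2 p q.
  rewrite -[Y p q]/(tc_trace (slice X p.2 q.2) * sigma1 p.1 q.1) XP linearZ /=.
  rewrite -[RHS]/(tc_trace P * (sigma1 p.1 q.1 * sigma2 p.2 q.2)).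
  by rewrite -[LHS]mulrA [LHS]mulrC -[LHS]mulrA.
have YZ : (Y : tc R _) = tc_trace P *: (prod_state sigma1 sigma2 : tc R _).
  by apply: val_inj; apply/funext => p; apply/funext => q; exact: YE.
have prod1 : tc_trace (prod_state sigma1 sigma2) = 1 := state_trace _.
(* The scalar is found by comparing traces: [Y] and the product state both have trace 1. *)
have P1 : tc_trace P = 1.
  have : tc_trace Y = 1 := state_trace Y.
  by rewrite YZ tc_traceZ prod1 mulr1.
by apply: state_inj => p q; rewrite YE P1 mul1r.
Qed.

End Trace.

Local Open Scope classical_set_scope.
Local Open Scope ereal_scope.

(** * Transfer to the class of systems *)

Section OutputMeasure.
Variables (R : realType) (Q : system_class) (M : resource_measure R Q).

(** Splitting and joining only relabel bases, so this is [prod_const_channel_state] at the split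
    input. *)
Lemma tensor_const_channel_state (s1 t1 s2 t2 : Q)
    (sigma1 : state R (onb t1)) (sigma2 : state R (onb t2))
    (rho : state R (onb (tensor s1 s2))) :
  channel_state (tensor_channel (const_channel (onb s1) sigma1)
                                (const_channel (onb s2) sigma2)) rho
  = tensor_state sigma1 sigma2.
Proof.
apply: state_inj => i j; rewrite /tensor_state.
by rewrite -(prod_const_channel_state sigma1 sigma2
               (channel_state (split_channel R s1 s2) rho)).
Qed.

Lemma tensor_channel_tens (s1 t1 s2 t2 : Q)
    (Phi1 : channel R (onb s1) (onb t1)) (Phi2 : channel R (onb s2) (onb t2))
    (rho1 : state R (onb s1)) (rho2 : state R (onb s2)) :
  channel_state (tensor_channel Phi1 Phi2) (tensor_state rho1 rho2)
  = tensor_state (channel_state Phi1 rho1) (channel_state Phi2 rho2).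
Proof.
apply: state_inj => i j.
have splitK : split_channel R s1 s2 (tensor_state rho1 rho2) = tens_tc rho1 rho2.
  apply: val_inj; apply/funext => p; apply/funext => q.
  rewrite -[LHS]/(tens_tc rho1 rho2 (split_onb (pair_onb p)) (split_onb (pair_onb q))).
  by rewrite !pair_onbK.
rewrite -[LHS]/(join_channel R t1 t2 (prod_channel Phi1 Phi2
   (split_channel R s1 s2 (tensor_state rho1 rho2))) i j).
by rewrite splitK prod_channel_tens.
Qed.

Lemma output_measure_eq (s t : Q) (Phi : channel R (onb s) (onb t)) (sigma : state R (onb t)) :
  (forall rho, channel_state Phi rho = sigma) -> output_measure M Phi = (M t sigma)%:E.
Proof.
move=> Phi_sigma; rewrite /output_measure.
(* An input state must exist: over an empty set the supremum would be -oo. *)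
have [e] := onb_inhabited s.
rewrite -[RHS]ereal_sup1; congr ereal_sup; apply/seteqP; split=> [_ [rho _ <-]|_ ->] /=.
  by rewrite Phi_sigma.
by exists (pure_state R e); rewrite ?Phi_sigma.
Qed.

End OutputMeasure.

Theorem mainTheorem5 (R : realType) (Q : system_class)
    (M : resource_measure R Q)
    (tensorization : forall (s1 t1 s2 t2 : Q)
      (Phi1 : channel R (onb s1) (onb t1))
      (Phi2 : channel R (onb s2) (onb t2)),
      output_measure M (tensor_channel Phi1 Phi2) =
        Order.max (output_measure M Phi1) (output_measure M Phi2))
    (s1 t1 s2 t2 : Q)
    (Phi1 : channel R (onb s1) (onb t1))
    (Phi2 : channel R (onb s2) (onb t2)) :
  ereal_sup [set (M (tensor t1 t2)
                    (channel_state (tensor_channel Phi1 Phi2) rho))%:E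
             | rho in [set: state R (onb (tensor s1 s2))]] =
  ereal_sup [set (M (tensor t1 t2)
                    (tensor_state (channel_state Phi1 rho1)
                                  (channel_state Phi2 rho2)))%:E
             | rho1 in [set: state R (onb s1)]
             & rho2 in [set: state R (onb s2)]].
Proof.
have M_tensor (sigma1 : state R (onb t1)) (sigma2 : state R (onb t2)) :
    (M _ (tensor_state sigma1 sigma2))%:E = Order.max (M _ sigma1)%:E (M _ sigma2)%:E.
  (* The choice of input systems is immaterial for constant channels; [t1] and [t2] are at hand. *)
  have := tensorization _ _ _ _ (const_channel (onb t1) sigma1) (const_channel (onb t2) sigma2).
  rewrite (output_measure_eq M (tensor_const_channel_state sigma1 sigma2)).
  by rewrite !(output_measure_eq M (const_channel_state _)).
apply/eqP; rewrite eq_le; apply/andP; split; last first.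
  (* Product inputs are particular joint inputs. *)
  apply: ereal_sup_le => _ [rho1 _ [rho2 _ <-]].
  by exists (tensor_state rho1 rho2) => //; rewrite tensor_channel_tens.
rewrite -[X in X <= _]/(output_measure M (tensor_channel Phi1 Phi2)) tensorization ge_max.
have [e1] := onb_inhabited s1; have [e2] := onb_inhabited s2.
(* Each [rho] on one factor is completed by a basis state on the other; by [M_tensor] the product
   output has at least the resource of either factor. *)
apply/andP; split; apply: ge_ereal_sup => _ [rho _ <-].
  apply: le_ereal_sup_tmp.
  exists (M _ (tensor_state (channel_state Phi1 rho)
                            (channel_state Phi2 (pure_state R e2))))%:E.
    by exists rho => //; exists (pure_state R e2).
  by rewrite M_tensor le_max lexx.
apply: le_ereal_sup_tmp.
exists (M _ (tensor_state (channel_state Phi1 (pure_state R e1))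
                          (channel_state Phi2 rho)))%:E.
  by exists (pure_state R e1) => //; exists rho.
by rewrite M_tensor le_max lexx orbT.
Qed.
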